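(* Let $G$ be a topological semigroup with identity acting continuously on a compact Hausdorff space $X$ by surjective continuous maps. Let $k\ge2$ and $(x_1,\dots,x_k)\in X^k\setminus\Delta_k(X)$. Then $(x_1,\dots,x_k)$ is a sequence entropy tuple if and only if it is an IN-tuple.
   Context: $\Delta_k(X)=\{(x,\dots,x)\}$. For $s\in G$ and $A\subseteq X$, $s^{-1}A=\{x\in X: sx\in A\}$. For a sequence $\mathfrak s=\{s_n\}_{n\in{\mathbb N}}$ in $G$ and a finite open cover ${\mathcal U}$ of $X$, ${\rm h}_{\rm top}(X,{\mathcal U};\mathfrak s)=\limsup_{n\to\infty}\frac1n\log N(\bigvee_{i=1}^n s_i^{-1}{\mathcal U})$, where $N(\cdot)$ is the minimal cardinality of a subcover. A tuple $(x_1,\dots,x_k)\in X^k\setminus\Delta_k(X)$ is a sequence entropy tuple if whenever $U_1,\dots,U_l$ are closed pairwise disjoint neighbourhoods of the distinct points in the list $x_1,\dots,x_k$, there is a sequence $\mathfrak s$ in $G$ with ${\rm h}_{\rm top}(X,\{U_1^{\rm c},\dots,U_l^{\rm c}\};\mathfrak s)>0$. For a tuple $(A_1,\dots,A_k)$ of subsets of $X$, $J\subseteq G$ is an independence set if for every nonempty finite $I\subseteq J$ and $\sigma:I\to\{1,\dots,k\}$, $\bigcap_{s\in I}s^{-1}A_{\sigma(s)}\neq\emptyset$. A tuple $(x_1,\dots,x_k)\in X^k$ is an IN-tuple if for every product neighbourhood $U_1\times\cdots\times U_k$ of it, $(U_1,\dots,U_k)$ has arbitrarily large finite independence sets. *)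

(* Defs.v *)
From HB Require Import structures.
From mathcomp Require Import all_boot all_order all_algebra.
From mathcomp Require Import all_classical all_reals all_analysis.
Set Implicit Arguments. Unset Strict Implicit. Unset Printing Implicit Defensive.
Import Order.TTheory GRing.Theory Num.Theory.
Local Open Scope classical_set_scope.
Local Open Scope ring_scope.

(* A finite cover of X is represented by a list of subsets of X. *)

Definition cover_preimage (X : Type) (f : X -> X) (U : seq (set X)) : seq (set X) :=
  [seq f @^-1` A | A <- U].

Definition cover_join (X : Type) (U V : seq (set X)) : seq (set X) :=
  [seq A `&` B | A <- U, B <- V].

Definition seq_join (G X : Type) (act : G -> X -> X) (s : nat -> G)
  (U : seq (set X)) (n : nat) : seq (set X) :=
  foldr (fun i V => cover_join (cover_preimage (act (s i)) U) V) [:: setT] (iota 1 n).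

Definition has_subcover_of_size (X : Type) (C : seq (set X)) (n : nat) : Prop :=
  exists idx : seq nat, size idx = n /\ all (fun i => i < size C)%N idx /\
    forall x : X, exists2 i, i \in idx & nth set0 C i x.

Definition Ncover (X : Type) (C : seq (set X)) : nat :=
  xget 0%N [set n | has_subcover_of_size C n /\
                    forall m, has_subcover_of_size C m -> (n <= m)%N].

Definition htop_seq (R : realType) (G X : Type) (act : G -> X -> X)
  (U : seq (set X)) (s : nat -> G) : \bar R :=
  limn_esup (fun n : nat => ((ln ((Ncover (seq_join act s U n))%:R : R)) / n%:R)%:E).

Definition off_diagonal (X : Type) (k : nat) (x : 'I_k -> X) : Prop :=
  ~ (forall i j, x i = x j).

Definition sequence_entropy_tuple (R : realType) (G : Type) (X : topologicalType)
  (act : G -> X -> X) (k : nat) (x : 'I_k -> X) : Prop :=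
  off_diagonal x /\
  forall (l : nat) (y : 'I_l -> X), injective y -> range y = range x ->
  forall U : 'I_l -> set X,
    (forall j, closed (U j) /\ nbhs (y j) (U j)) ->
    (forall i j, i != j -> U i `&` U j = set0) ->
    exists s : nat -> G,
      (0 < htop_seq R act [seq ~` U j | j <- enum 'I_l] s)%E.

Definition independence_set (G X : Type) (act : G -> X -> X) (k : nat)
  (A : 'I_k -> set X) (J : set G) : Prop :=
  forall I : set G, finite_set I -> I !=set0 -> I `<=` J ->
  forall sigma : G -> 'I_k,
    exists x : X, forall s, I s -> A (sigma s) (act s x).

Definition arb_large_independence (G X : Type) (act : G -> X -> X) (k : nat)
  (A : 'I_k -> set X) : Prop :=
  forall n : nat, exists J : set G,
    finite_set J /\ independence_set act A J /\
    exists f : 'I_n -> G, injective f /\ range f `<=` J.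

Definition IN_tuple (G : Type) (X : topologicalType) (act : G -> X -> X)
  (k : nat) (x : 'I_k -> X) : Prop :=
  forall U : 'I_k -> set X, (forall i, nbhs (x i) (U i)) ->
    arb_large_independence act U.

(* Main.v *)
(* Let [U] be a family of [l >= 2] disjoint sets.  If the elements
   [s_{b_1}, ..., s_{b_p}] with [b_j <= n] realise every pattern of visits to the
   sets [U_j], then the points of one member of the [n]-fold joined cover realise at
   most [(l - 1) ^ p] of the [l ^ p] patterns, so that a subcover has at least
   [(1 - 1 / l) ^ - p >= e ^ (p / l)] members; concatenating independent blocks of
   lengths [1, 2, 4, ...] gives [p >= n / 2] infinitely often and hence a sequence of
   positive entropy.  Conversely, view a point [x] as the partial colouring of
   [{1, ..., n}] that gives [i] the colour [j] when [s_i x] lies in [U_j].  If these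
   colourings shatter no set of more than [m] indices, they shatter at most
   [(n + 1) ^ m] sets.  Picking at each index a colour whose slice shatters the
   fewest sets, one member of the joined cover leaves out only points of [n] slices,
   each shattering fewer sets by the factor [1 - 1 / l]; after [O(log n)] rounds [X]
   is covered by [(n + 1) ^ O(log n)] members, and the entropy along [s] vanishes. *)
Require Import Defs.
From HB Require Import structures.
From mathcomp Require Import all_boot all_order all_algebra.
From mathcomp Require Import all_classical all_reals all_analysis.
From mathcomp Require Import zify ring.
Set Implicit Arguments. Unset Strict Implicit. Unset Printing Implicit Defensive.
Import Order.TTheory GRing.Theory Num.Theory numFieldNormedType.Exports.
Local Open Scope classical_set_scope.
Local Open Scope nat_scope.

Lemma injective_extension (I Z K : Type) (f : I -> Z) (k : K) (tau : I -> K) :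
  injective f -> exists sigma : Z -> K, forall i, sigma (f i) = tau i.
Proof.
move=> injf; have /choice[sigma sigmaP] z : exists c, forall i, f i = z -> c = tau i.
  have [[i <-]|nfz] := pselect (exists i, f i = z).
    by exists (tau i) => j /injf ->.
  by exists k => i fiz; case: nfz; exists i.
by exists sigma => i; exact: sigmaP.
Qed.

Lemma exists_neq (T : finType) (x : T) : 1 < #|T| -> exists y, y != x.
Proof.
move=> /card_gt1P[a [b [_ _ ab]]].
by have [<-|] := eqVneq a x; [exists b; rewrite eq_sym | exists a].
Qed.

Lemma exists_le_mean (I : finType) (i0 : I) (F : I -> nat) :
  exists i, #|I| * F i <= \sum_i F i.
Proof.
case: (arg_minnP F (isT : predT i0)) => i _ Fi; exists i.
by rewrite -sum_nat_const leq_sum // => j _; exact: Fi.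
Qed.

Lemma card_le_exists_forall (T : finType) (Q : pred T) :
  #|Q| <= #|T|.-1 * [exists x, Q x] + [forall x, Q x].
Proof.
case: (pickP Q) => [x Qx|noQ]; last by rewrite eq_card0.
have T_gt0 : 0 < #|T| by apply/card_gt0P; exists x.
have -> : [exists x, Q x] by apply/existsP; exists x.
have [_|/forallPn[y nQy]] := boolP [forall x, Q x].
  by rewrite muln1 addn1 prednK // max_card.
rewrite muln1 addn0 -ltnS prednK // proper_card //.
apply/fintype.properP; split; first exact/fintype.subsetP.
by exists y; rewrite // ssrbool.inE.
Qed.

Lemma card_small_sets_le (T : finType) m :
  #|[pred A : {set T} | #|A| <= m]| <= #|T|.+1 ^ m.
Proof.
elim: m => [|m IH].
  rewrite expn0 -(card1 (finset.set0 : {set T})).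
  apply/subset_leq_card/fintype.subsetP => A.
  by rewrite !ssrbool.inE leqn0 cards_eq0.
pose small := [pred A : {set T} | #|A| <= m].
pose insert (p : option T * {set T}) := if p.1 is Some z then z |: p.2 else p.2.
apply: (@leq_trans #|[predX {: option T} & small]|); last first.
  by rewrite cardX card_option expnS leq_mul2l IH orbT.
apply: leq_trans (leq_image_card insert _).
apply/subset_leq_card/fintype.subsetP => A; rewrite ssrbool.inE => Am.
apply/fintype.imageP; have [->|[z zA]] := set_0Vmem A.
  by exists (None, finset.set0); rewrite // !ssrbool.inE /= cards0.
exists (Some z, A :\ z)%SET; last by rewrite /insert /= finset.setD1K.
by rewrite !ssrbool.inE /= -ltnS (leq_trans _ Am) // [#|A|](cardsD1 z) zA.
Qed.

Lemma card_has_le (T : finType) (I : Type) (Q : I -> pred T) (s : seq I) c :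
  (forall i, #|Q i| <= c) -> #|[pred t | has (Q^~ t) s]| <= size s * c.
Proof.
move=> Qc; elim: s => [|i s IH] /=; first by rewrite eq_card0.
rewrite mulSn (leq_trans _ (leq_add (Qc i) IH)) // -cardUI.
by rewrite (leq_trans _ (leq_addr _ _)).
Qed.

Lemma card_differing_functions (I K : finType) (g : I -> K) :
  #|[pred f : {ffun I -> K} | [forall i, f i != g i]]| = #|K|.-1 ^ #|I|.
Proof.
rewrite -(eq_card (_ : family (fun i => predC1 (g i)) =i _)) => [|f].
  rewrite card_family foldrE big_image /= (eq_bigr (fun=> #|K|.-1)).
    by rewrite prod_nat_const.
  by move=> i _; rewrite cardC1.
by rewrite !ssrbool.inE.
Qed.

Section IndependentFamily.
Variables (T Z : Type) (K : finType) (P : Z -> K -> set T).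

Definition independent_family (I : Type) (f : I -> Z) : Prop :=
  forall tau : I -> K, exists x, forall i, P (f i) (tau i) x.

Lemma independent_family_inj (I : eqType) (f : I -> Z) :
  (forall z, trivIset setT (P z)) -> 1 < #|K| ->
  independent_family f -> injective f.
Proof.
move=> P_triv /card_gt1P[c [d [_ _ cd]]] indf i j fij.
apply/eqP/negPn/negP => ij; move/eqP: cd; apply.
have [x xP] := indf (fun h => if h == i then c else d).
apply: (@P_triv (f i)) => //; exists x; split; first by have := xP i; rewrite eqxx.
by have := xP j; rewrite eq_sym (negPf ij) -fij.
Qed.

(* The block of length [2 ^ N] occupies the positions from [2 ^ N] to [2 ^ N.+1 - 1]. *)
Lemma dyadic_independent_sequence :
  (forall n, 0 < n -> exists f : 'I_n -> Z, independent_family f) ->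
  exists s : nat -> Z,
    forall N, independent_family (fun j : 'I_(2 ^ N) => s (2 ^ N + j)).
Proof.
move=> indep.
have /choice[f fP] N : exists f : nat -> Z,
    independent_family (fun j : 'I_(2 ^ N) => f j).
  have pow_gt0 : 0 < 2 ^ N by rewrite expn_gt0.
  have [f indf] := indep _ pow_gt0.
  have [h hP] := injective_extension (f (Ordinal pow_gt0)) f (@ord_inj (2 ^ N)).
  by exists h => tau; have [x xP] := indf tau; exists x => j; rewrite hP.
exists (fun i => f (trunc_log 2 i) (i - 2 ^ trunc_log 2 i)) => N tau.
have [x xP] := fP N tau; exists x => j.
rewrite (@trunc_log_eq 2 N) ?addKn //.
by rewrite leq_addr expnS mul2n -addnn ltn_add2l ltn_ord.
Qed.

End IndependentFamily.

Section Shattering.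
Variables (T : Type) (Z K : finType) (P : Z -> K -> set T).

Definition shatters (S : set T) (J : {set Z}) : bool :=
  `[< forall sigma : Z -> K,
        exists2 x, S x & forall z, z \in J -> P z (sigma z) x >].

Definition nshattered (S : set T) : nat := #|[pred J | shatters S J]|.

Definition avoids (g : {ffun Z -> K}) : set T := [set x | forall z, ~ P z (g z) x].

Definition avoiding_cover (S : set T) (gs : seq {ffun Z -> K}) : Prop :=
  forall x, S x -> exists2 g, g \in gs & avoids g x.

Hypothesis P_triv : forall z, trivIset setT (P z).
Hypothesis K_gt1 : 1 < #|K|.

Lemma shatters_slice_notin S z c (J : {set Z}) :
  shatters (S `&` P z c) J -> z \notin J.
Proof.
move=> /asboolP sh; apply/negP => zJ; have [d dc] := exists_neq c K_gt1.
have [x [_ Pc] /(_ z zJ) Pd] := sh (fun=> d).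
by move/eqP: dc; apply; apply: (@P_triv z) => //; exists x.
Qed.

Lemma shatters_slice S z c J : shatters (S `&` P z c) J -> shatters S J.
Proof.
by move=> /asboolP sh; apply/asboolP => s; have [x [Sx _] ?] := sh s; exists x.
Qed.

Lemma shatters_setU1 S z J :
  (forall c, shatters (S `&` P z c) J) -> shatters S (z |: J).
Proof.
move=> sh; apply/asboolP => s; have /asboolP/(_ s)[x [Sx Pzx] PJ] := sh (s z).
by exists x => // w; rewrite in_setU1 => /predU1P[->|/PJ].
Qed.

(* A set [J] shattered by every slice contributes [z |: J] as well as [J] to the
   sets shattered by [S]. *)
Lemma nshattered_slices S z :
  #|[pred J | [exists c, shatters (S `&` P z c) J]]| +
  #|[pred J | [forall c, shatters (S `&` P z c) J]]| <= nshattered S.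
Proof.
have /card_gt1P[c0 _] := K_gt1.
set A := [pred J | _]; set B := [pred J | _].
have B_notin J : J \in B -> z \notin J.
  by move=> /forallP/(_ c0); exact: shatters_slice_notin.
have <- : #|[seq z |: J | J in B]| = #|B|.
  apply: card_in_image => J1 J2 /B_notin z1 /B_notin z2 eqJ.
  by rewrite -(finset.setU1K z1) -(finset.setU1K z2) eqJ.
rewrite -cardUI [X in _ + X]eq_card0 ?addn0 => [|J].
  apply/subset_leq_card/fintype.subsetP => J; rewrite !ssrbool.inE.
  move=> /orP[/existsP[c]|]; first exact: shatters_slice.
  by move=> /fintype.imageP[J' /forallP J'B ->]; exact: shatters_setU1.
apply/negP; rewrite !ssrbool.inE => /andP[/existsP[c /shatters_slice_notin zJ]].
by move=> /fintype.imageP[J' _ JE]; rewrite JE setU11 in zJ.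
Qed.

Lemma sum_nshattered_slices S z :
  \sum_c nshattered (S `&` P z c) <= #|K|.-1 * nshattered S.
Proof.
have sum_pred (p : pred {set Z}) : \sum_J p J = #|[pred J | p J]|.
  by rewrite -sum1_card [RHS]big_mkcond.
apply: leq_trans (leq_mul (leqnn _) (nshattered_slices S z)).
have -> : \sum_c nshattered (S `&` P z c) =
    \sum_J #|[pred c | shatters (S `&` P z c) J]|.
  under eq_bigr do rewrite /nshattered -sum_pred.
  by rewrite exchange_big; apply: eq_bigr => J _; rewrite -sum1_card [RHS]big_mkcond.
apply: leq_trans (leq_sum _ (fun J _ => card_le_exists_forall _)) _.
rewrite big_split -big_distrr /= !sum_pred mulnDr leq_add2l leq_pmull //.
by rewrite -ltnS prednK // ltnW.
Qed.

Lemma nshattered_slice_le S z :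
  exists c, #|K| * nshattered (S `&` P z c) <= #|K|.-1 * nshattered S.
Proof.
have /card_gt1P[c0 _] := K_gt1.
have [c c_le] := exists_le_mean c0 (fun c => nshattered (S `&` P z c)).
by exists c; exact: leq_trans c_le (sum_nshattered_slices S z).
Qed.

Lemma nshattered_eq0 S : nshattered S = 0 -> S = set0.
Proof.
move=> /card0_eq/(_ finset.set0); rewrite !ssrbool.inE => noS.
apply/seteqP; split=> // x Sx; move/negP: noS; apply.
by apply/asboolP => s; exists x => // z; rewrite finset.in_set0.
Qed.

(* Choose [g z] for each [z] by [nshattered_slice_le]: the points of [S] that [g]
   does not avoid lie in one of the slices [S `&` P z (g z)], and each of these
   shatters fewer sets by the factor [1 - 1 / #|K|]. *)
Lemma exists_avoiding_cover S t : nshattered S * #|K|.-1 ^ t < #|K| ^ t ->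
  exists2 gs, avoiding_cover S gs & size gs <= #|Z|.+1 ^ t.
Proof.
elim: t S => [|t IH] S.
  rewrite !expn0 muln1 ltnS leqn0 => /eqP/nshattered_eq0 ->.
  by exists [::].
move=> nS; have /fin_all_exists[g gP] := nshattered_slice_le S.
have /fin_all_exists2[h hP size_h] z : exists2 gs,
    avoiding_cover (S `&` P z (g z)) gs & size gs <= #|Z|.+1 ^ t.
  apply: IH; rewrite -(ltn_pmul2l (ltnW K_gt1)) -expnS.
  apply: leq_ltn_trans nS; rewrite mulnA expnS mulnA [nshattered S * _]mulnC.
  by rewrite leq_mul2r gP orbT.
exists (finfun g :: flatten [seq h z | z <- enum Z]) => [x Sx|/=]; last first.
  rewrite size_flatten sumnE big_map big_map big_enum expnS mulSn.
  by rewrite -add1n leq_add ?expn_gt0 // -sum_nat_const leq_sum.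
have [[z Pz]|noz] := pselect (exists z, P z (g z) x).
  have [g' g'h g'P] := hP z x (conj Sx Pz); exists g' => //.
  rewrite in_cons; apply/orP; right.
  by apply/flattenP; exists (h z) => //; apply: map_f; rewrite mem_enum.
exists (finfun g); first by rewrite mem_head.
by move=> z; rewrite ffunE => Pz; apply: noz; exists z.
Qed.

Lemma nshattered_le S m :
  (forall J, shatters S J -> #|J| <= m) -> nshattered S <= #|Z|.+1 ^ m.
Proof.
move=> shm; apply: leq_trans (card_small_sets_le Z m).
by apply/subset_leq_card/fintype.subsetP => J; exact: shm.
Qed.

Lemma shatters_independent_family J m : shatters setT J -> m <= #|J| ->
  exists f : 'I_m -> Z, independent_family P f.
Proof.
move=> /asboolP sh mJ; have /card_gt1P[c0 _] := K_gt1.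
pose f (i : 'I_m) := enum_val (widen_ord mJ i); exists f => tau.
have f_inj : injective f by move=> i j /enum_val_inj[/ord_inj].
have [sigma sigmaP] := injective_extension c0 tau f_inj.
have [x _ xP] := sh sigma; exists x => i; rewrite -sigmaP; apply: xP.
exact: enum_valP.
Qed.

Lemma independent_family_avoiding_cover (A : finType) (b : A -> Z) gs :
  independent_family P b -> avoiding_cover setT gs ->
  #|K| ^ #|A| <= size gs * #|K|.-1 ^ #|A|.
Proof.
move=> indep cov.
pose differ (g : {ffun Z -> K}) :=
  [pred tau : {ffun A -> K} | [forall i, tau i != g (b i)]].
have := @card_has_le _ _ differ gs _
  (fun g => eq_leq (card_differing_functions (g \o b))).
apply: leq_trans; rewrite -card_ffun.
apply/subset_leq_card/fintype.subsetP => tau _.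
have [x xP] := indep tau; have [g ggs gx] := cov x I.
apply/hasP; exists g => //; apply/forallP => i; apply/eqP => tau_g.
by apply: (gx (b i)); rewrite -tau_g.
Qed.

End Shattering.

Section SubcoverNumber.
Variables (X : Type) (C : seq (set X)).

Definition is_cover (D : seq (set X)) : Prop :=
  forall x, exists2 A, A \in D & A x.

Lemma has_subcover_of_sizeP n : has_subcover_of_size C n <->
  exists2 D, {subset D <= C} /\ is_cover D & size D = n.
Proof.
split=> [[idx [<- [/allP idxC cov]]]|[D [DC covD] <-]].
  exists [seq nth set0 C i | i <- idx]; last by rewrite size_map.
  split=> [_ /mapP[i /idxC iC ->]|x]; first exact: mem_nth.
  by have [i ii ix] := cov x; exists (nth set0 C i); first exact: map_f.
exists [seq index A C | A <- D]; rewrite size_map; split=> //; split=> [|x].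
  by apply/allP => _ /mapP[A /DC AC ->]; rewrite index_mem.
have [A AD Ax] := covD x; exists (index A C); first exact: map_f.
by rewrite nth_index // DC.
Qed.

Lemma NcoverP m : has_subcover_of_size C m ->
  has_subcover_of_size C (Ncover C) /\ Ncover C <= m.
Proof.
move=> /asboolP Cm; rewrite /Ncover; case: xgetP => [n -> [Cn nmin]|none].
  by split=> //; exact/nmin/asboolP.
have [n /asboolP nC nmin] :=
  ex_minnP (ex_intro (fun n => `[< has_subcover_of_size C n >]) _ Cm).
by case: (none n); split=> // i /asboolP; exact: nmin.
Qed.

Lemma Ncover_le D : {subset D <= C} -> is_cover D -> Ncover C <= size D.
Proof.
move=> DC covD.
by have [|//] := @NcoverP (size D); apply/has_subcover_of_sizeP; exists D.
Qed.

Lemma Ncover_attained : is_cover C ->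
  exists2 D, {subset D <= C} /\ is_cover D & size D = Ncover C.
Proof.
move=> covC.
have [|/has_subcover_of_sizeP//] := @NcoverP (size C).
by apply/has_subcover_of_sizeP; exists C => //; split=> // A.
Qed.

End SubcoverNumber.

Lemma bigcap_ord_recl (X : Type) n (F : 'I_n.+1 -> set X) :
  \bigcap_i F i = F ord0 `&` \bigcap_i F (lift ord0 i).
Proof.
apply/seteqP; split=> [x xF|x [F0 FS] i _]; first by split=> [|i _]; exact: xF.
by case: (unliftP ord0 i) => [j ->|-> //]; exact: FS.
Qed.

Section RealEstimates.
Variable R : realType.
Local Open Scope ring_scope.

Lemma ler_ln_nat m n : (m <= n)%N -> ln (m%:R : R) <= ln n%:R.
Proof.
case: m n => [|m] [|n] // mn; first by rewrite ln0 // ln_ge0 // ler1n.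
by rewrite ler_ln ?posrE ?ltr0n // ler_nat.
Qed.

Lemma expn_le_mul_pred_expn l a p : (1 < l)%N ->
  (l ^ p <= a * l.-1 ^ p)%N -> p%:R <= l%:R * ln (a%:R : R).
Proof.
move=> l_gt1 lp; have a_gt0 : (0 < a)%N.
  by rewrite lt0n; apply: contraTneq lp => ->; rewrite -ltnNge expn_gt0 ltnW.
have l_gt0 : 0 < l%:R :> R by rewrite ltr0n ltnW.
have l1_gt0 : 0 < l.-1%:R :> R by rewrite ltr0n -ltnS prednK // ltnW.
have ln_pred : ln (l.-1%:R : R) <= ln l%:R - l%:R^-1.
  have -> : l.-1%:R = l%:R * (1 + - l%:R^-1) :> R.
    by rewrite mulrDr mulr1 mulrN divff ?gt_eqF // -subn1 natrB // ltnW.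
  have inv_lt1 : l%:R^-1 < 1 :> R by rewrite invf_lt1 // ltr1n.
  by rewrite lnM ?posrE ?subr_gt0 // lerD2l le_ln1Dx // ltrN2.
have : ln (l%:R ^+ p : R) <= ln (a%:R * l.-1%:R ^+ p).
  by rewrite -!natrX -natrM ler_ln_nat.
rewrite lnM ?posrE ?exprn_gt0 // ?ltr0n // !lnXn // -![ln _ *+ p]mulr_natl => ln_le.
rewrite -ler_pdivrMl // mulrC.
rewrite -(lerD2r (p%:R * ln l.-1%:R)); apply: le_trans ln_le.
by rewrite -mulrDr ler_wpM2l // -lerBrDl.
Qed.

Lemma ln_exprn_le k (x : R) : 1 <= x -> ln x ^+ k <= k`!%:R * x.
Proof.
case: k => [|k] x1; first by rewrite expr0 mul1r.
have := expR_ge1Dxn k (ln_ge0 x1); rewrite lnK ?posrE ?(lt_le_trans ltr01) //.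
rewrite -ler_pdivrMl ?ltr0n ?fact_gt0 // mulrC; apply: le_trans.
by rewrite lerDr.
Qed.

Lemma cvgr_ln_exprn_div k : @ln R x ^+ k / x @[x --> +oo] --> 0.
Proof.
apply/cvgr0Pnorm_le => e e_gt0; near=> x.
have fact_gt0 : 0 < k.+1`!%:R :> R by rewrite ltr0n fact_gt0.
have x1 : 1 <= x by near: x; exact: nbhs_pinfty_ge.
have x_gt0 : 0 < x by exact: lt_le_trans x1.
have ln_ge : k.+1`!%:R / e <= ln x.
  by rewrite -ler_expR lnK ?posrE //; near: x; exact: nbhs_pinfty_ge.
have lnk_ge0 : 0 <= ln x ^+ k by rewrite exprn_ge0 // ln_ge0.
rewrite ger0_norm ?divr_ge0 ?(ltW x_gt0) // ler_pdivrMr //.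
rewrite -(ler_pM2l (divr_gt0 fact_gt0 e_gt0)) mulrA divfK ?gt_eqF //.
by apply: le_trans (ler_wpM2r lnk_ge0 ln_ge) _; rewrite -exprS ln_exprn_le.
Unshelve. all: by end_near. Qed.

End RealEstimates.

Section LimfEsup.
Variables (T : choiceType) (X : filteredType T) (R : realType).
Implicit Types (F : set_system X) (f : X -> \bar R).
Local Open Scope ereal_scope.

Lemma limf_esup_le_cvg F f (g : X -> R) (c : R) : Filter F ->
  (\forall x \near F, f x <= (g x)%:E) -> g @ F --> c -> limf_esup f F <= c%:E.
Proof.
move=> FF fg gc; apply/lee_addgt0Pr => e e_gt0; rewrite limf_esupE -EFinD.
pose A := [set x | f x <= (c + e)%:E].
apply: (@le_trans _ _ (ereal_sup (f @` A))); last first.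
  by apply: ge_ereal_sup => _ [x Ax <-].
apply: ereal_inf_lbound; exists A => //.
have g_le : \forall x \near F, (g x <= c + e)%R.
  by apply: cvgr_le gc _ _; rewrite ltrDl.
by apply: filterS2 fg g_le => x fx gx; apply: le_trans fx _; rewrite lee_fin.
Qed.

Lemma limf_esup_ge_frequently F f (c : \bar R) :
  (forall A, F A -> exists2 x, A x & c <= f x) -> c <= limf_esup f F.
Proof.
move=> freq; rewrite limf_esupE; apply: le_ereal_inf_tmp => _ [A FA <-].
have [x Ax cx] := freq A FA; apply: le_trans cx _.
by apply: ereal_sup_ubound; exists x.
Qed.

End LimfEsup.

Section SequenceJoin.
Variables (G X : Type) (act : G -> X -> X).

Lemma seq_joinS s (V : seq (set X)) n : seq_join act s V n.+1 =
  cover_join (cover_preimage (act (s 1)) V) (seq_join act (s \o S) V n).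
Proof. by rewrite /seq_join /= -[2]/(1 + 1) iotaDl foldr_map. Qed.

Lemma mem_seq_join s (V : seq (set X)) n A : A \in seq_join act s V n <->
  exists2 B : 'I_n -> set X, (forall i, B i \in V) &
    A = \bigcap_(i : 'I_n) (act (s i.+1) @^-1` B i).
Proof.
elim: n s A => [|n IH] s A.
  have -> : seq_join act s V 0 = [:: setT] by [].
  rewrite mem_seq1; split=> [/eqP ->|[B _ ->]].
    by exists (fun=> set0) => [[]//|]; apply/seteqP; split=> // x _ [].
  by apply/eqP/seteqP; split=> // x _ [].
rewrite seq_joinS; split=> [/allpairsP[[D E] /=]|[B BV ->]].
  move=> [/mapP[B0 B0V ->] /IH[B BV ->] ->].
  exists (fun i => if unlift ord0 i is Some j then B j else B0).
    by move=> i; case: unliftP.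
  rewrite bigcap_ord_recl unlift_none; congr (_ `&` _).
  by apply: eq_bigcap => // i _; rewrite liftK.
rewrite bigcap_ord_recl; apply/allpairsP.
exists (act (s 1) @^-1` B ord0,
        \bigcap_(i : 'I_n) (act (s (lift ord0 i).+1) @^-1` B (lift ord0 i))).
split=> //=; first exact: map_f.
by apply/IH; exists (B \o lift ord0) => // i; exact: BV.
Qed.

Variables (s : nat -> G) (K : finType) (U : K -> set X).

Definition pullback (g : G) (c : K) : set X := act g @^-1` U c.

(* The index [i : 'I_n] stands for the time [i.+1], as [seq_join] starts at [s 1]. *)
Definition visits n (i : 'I_n) : K -> set X := pullback (s i.+1).

Definition complements : seq (set X) := [seq ~` U c | c <- enum K].

Definition joined_cover n : seq (set X) := seq_join act s complements n.

Lemma mem_joined_cover n A : A \in joined_cover n <->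
  exists g : {ffun 'I_n -> K}, A = avoids (@visits n) g.
Proof.
split=> [/mem_seq_join[B BV ->]|[g ->]]; last first.
  apply/mem_seq_join; exists (fun i => ~` U (g i)).
    by move=> i; apply: (map_f (fun c => ~` U c)); rewrite mem_enum.
  by apply/seteqP; split=> x xg i; [move=> _; exact: xg | exact: (xg i I)].
have /fin_all_exists[g gP] i : exists c, B i = ~` U c.
  by have /mapP[c _ ->] := BV i; exists c.
exists (finfun g); apply/seteqP; split=> x xg i.
  by have := xg i I; rewrite ffunE gP.
by move=> _; rewrite gP; have := xg i; rewrite ffunE.
Qed.

Lemma Ncover_joined_cover_le n gs :
  avoiding_cover (@visits n) setT gs -> Ncover (joined_cover n) <= size gs.
Proof.
move=> cov; rewrite -(size_map (avoids (@visits n))).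
apply: Ncover_le => [_ /mapP[g _ ->]|x]; first by apply/mem_joined_cover; exists g.
by have [g ggs gx] := cov x I; exists (avoids (@visits n) g); first exact: map_f.
Qed.

Hypothesis U_triv : trivIset setT U.
Hypothesis K_gt1 : 1 < #|K|.

Lemma trivIset_pullback g : trivIset setT (pullback g).
Proof. by move=> c d _ _ [x [xc xd]]; apply: U_triv => //; exists (act g x). Qed.

Lemma joined_cover_is_cover n : is_cover (joined_cover n).
Proof.
have /card_gt1P[c _] := K_gt1; have [d dc] := exists_neq c K_gt1; move=> x.
have /fin_all_exists[g gP] (i : 'I_n) : exists a, ~ visits i a x.
  have [xc|] := pselect (visits i c x); last by exists c.
  exists d => xd; move/eqP: dc; apply.
  by apply: (@trivIset_pullback (s i.+1)) => //; exists x.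
exists (avoids (@visits n) (finfun g)); last by move=> i; rewrite ffunE.
by apply/mem_joined_cover; exists (finfun g).
Qed.

Lemma Ncover_joined_cover_attained n :
  exists2 gs, avoiding_cover (@visits n) setT gs & size gs = Ncover (joined_cover n).
Proof.
have /card_gt1P[c0 _] := K_gt1.
have [D [DC covD] <-] := Ncover_attained (@joined_cover_is_cover n).
have /choice[h hP] A : exists g : {ffun 'I_n -> K}, A \in D -> A = avoids (@visits n) g.
  have [/DC/mem_joined_cover[g ->]|_] := boolP (A \in D); first by exists g.
  by exists [ffun=> c0].
exists (map h D) => [x _|]; last by rewrite size_map.
have [A AD Ax] := covD x; exists (h A); first exact: map_f.
by rewrite -hP.
Qed.

Section Entropy.
Variable R : realType.
Local Open Scope ring_scope.

Lemma ln_Ncover_ge n p (b : 'I_p -> 'I_n) : independent_family (@visits n) b ->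
  p%:R <= #|K|%:R * ln ((Ncover (joined_cover n))%:R : R).
Proof.
move=> indep; have [gs cov <-] := Ncover_joined_cover_attained n.
apply: expn_le_mul_pred_expn => //.
by have := independent_family_avoiding_cover indep cov; rewrite card_ord.
Qed.

Lemma ln_Ncover_le n m : (forall J, shatters (@visits n) setT J -> (#|J| <= m)%N) ->
  ln ((Ncover (joined_cover n))%:R : R) <=
  (#|K|%:R * m%:R * ln n.+1%:R + 1) * ln n.+1%:R.
Proof.
move=> shm; set y := ln n.+1%:R; pose t := (Num.truncn (#|K|%:R * m%:R * y)).+1.
have y_ge0 : 0 <= y by rewrite ln_ge0 // ler1n.
have [gs cov size_gs] : exists2 gs,
    avoiding_cover (@visits n) setT gs & (size gs <= #|'I_n|.+1 ^ t)%N.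
  apply: exists_avoiding_cover => // [i|]; first exact: trivIset_pullback.
  rewrite ltnNge; apply/negP => /(expn_le_mul_pred_expn R K_gt1).
  apply/negP; rewrite -ltNge; apply: le_lt_trans (truncnS_gt _).
  rewrite -mulrA ler_wpM2l // mulr_natl -lnXn ?ltr0n // -natrX ler_ln_nat //.
  by rewrite -[n in n.+1]card_ord nshattered_le.
apply: (@le_trans _ _ (ln (n.+1 ^ t)%:R)).
  rewrite ler_ln_nat // -[n in n.+1]card_ord.
  exact: leq_trans (Ncover_joined_cover_le cov) size_gs.
rewrite natrX lnXn ?ltr0n // -[leLHS]mulr_natl ler_wpM2r // -natr1 lerD2r.
by rewrite truncn_le !mulr_ge0.
Qed.

Lemma htop_seq_le0 m :
  (forall n J, shatters (@visits n) setT J -> (#|J| <= m)%N) ->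
  (htop_seq R act complements s <= 0)%E.
Proof.
move=> shm; pose a : R := #|K|%:R * m%:R.
pose q k n : R := ln n.+1%:R ^+ k / n.+1%:R.
have q_cvg0 k : q k n @[n --> \oo] --> 0.
  apply: (cvg_comp (fun n => n.+1%:R) _ _ (@cvgr_ln_exprn_div R k)).
  by rewrite (cvg_shiftS (fun n => n%:R : R)); exact: cvgr_idn.
apply: (@limf_esup_le_cvg _ _ _ _ _ (fun n => 2 * (a * q 2 n + q 1 n))).
  near=> n; have n_gt0 : (0 < n)%N by near: n; exact: nbhs_infty_gt.
  rewrite lee_fin ler_pdivrMr ?ltr0n //; apply: le_trans (ln_Ncover_le (@shm n)) _.
  have ratio_ge1 : 1 <= 2 * n%:R / n.+1%:R :> R.
    by rewrite ler_pdivlMr ?ltr0n // mul1r -natrM ler_nat; lia.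
  have y_ge0 : 0 <= ln (n.+1%:R : R) by rewrite ln_ge0 // ler1n.
  have -> : 2 * (a * q 2 n + q 1 n) * n%:R =
      (a * ln n.+1%:R + 1) * ln n.+1%:R * (2 * n%:R / n.+1%:R).
    by rewrite /q; field; rewrite nat1r pnatr_eq0.
  by rewrite ler_peMr ?mulr_ge0 ?addr_ge0 ?mulr_ge0.
rewrite -[0](_ : 2 * (a * 0 + 0) = 0); last by rewrite mulr0 addr0 mulr0.
by apply: cvgMr; apply: cvgD => //; apply: cvgMr.
Unshelve. all: by end_near. Qed.

Lemma htop_seq_gt0_independent :
  (0 < htop_seq R act complements s)%E ->
  forall m, exists f : 'I_m -> G, independent_family pullback f.
Proof.
move=> hpos m; apply: contrapT => no_indep; move: hpos; apply/negP; rewrite -leNgt.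
apply: (@htop_seq_le0 m) => n J shJ; rewrite leqNgt; apply/negP => /ltnW mJ.
have [f indf] := shatters_independent_family K_gt1 shJ mJ.
by apply: no_indep; exists (fun j => s (f j).+1).
Qed.

Lemma dyadic_independent_htop_seq_gt0 :
  (forall N, independent_family pullback (fun j : 'I_(2 ^ N) => s (2 ^ N + j)%N)) ->
  (0 < htop_seq R act complements s)%E.
Proof.
move=> indep; have K_gt0 : 0 < #|K|%:R :> R by rewrite ltr0n ltnW.
apply: (@lt_le_trans _ _ ((2 * #|K|%:R)^-1)%:E).
  by rewrite lte_fin invr_gt0 mulr_gt0.
apply: limf_esup_ge_frequently => A [N _ NA]; pose n := (2 ^ N.+1).-1.
have Nlt : (N < 2 ^ N)%N by exact: ltn_expl.
have nE : (n.+1 = 2 * 2 ^ N)%N by rewrite -expnS prednK // expn_gt0.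
exists n; first by apply: NA => /=; lia.
have jn (j : 'I_(2 ^ N)) : ((2 ^ N + j).-1 < n)%N by have := ltn_ord j; lia.
have indep_n : independent_family (@visits n) (fun j => Ordinal (jn j)).
  move=> tau; have [x xP] := indep N tau; exists x => j.
  by rewrite /visits /= prednK //; lia.
rewrite lee_fin ler_pdivlMr ?ltr0n ?ler_pdivrMl ?mulr_gt0 //; last by lia.
rewrite -mulrA; apply: le_trans (ler_wpM2l _ (ln_Ncover_ge indep_n)) => //.
by rewrite -natrM ler_nat; lia.
Qed.

End Entropy.

End SequenceJoin.

Section IndependenceSets.
Variables (G X : Type) (act : G -> X -> X).
Local Open Scope ring_scope.

Lemma arb_large_independence_mono k l (pi : 'I_l -> 'I_k)
    (A : 'I_k -> set X) (B : 'I_l -> set X) :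
  (forall j, A (pi j) `<=` B j) ->
  arb_large_independence act A -> arb_large_independence act B.
Proof.
move=> AB indA n; have [J [Jfin [Jind Jn]]] := indA n.
exists J; split=> //; split=> // I Ifin I0 IJ sigma.
have [x xP] := Jind I Ifin I0 IJ (pi \o sigma).
by exists x => g /xP; exact: AB.
Qed.

Variables (l : nat) (A : 'I_l -> set X).
Hypothesis l_gt1 : (1 < l)%N.

Lemma arb_large_independence_family n : arb_large_independence act A -> (0 < n)%N ->
  exists f : 'I_n -> G, independent_family (pullback act A) f.
Proof.
move=> indA n_gt0; have [J [_ [Jind [f [f_inj fJ]]]]] := indA n; exists f => tau.
have [sigma sigmaP] := injective_extension (Ordinal (ltnW l_gt1)) tau f_inj.
have [||x xP] := Jind (range f) _ _ fJ sigma; first exact: finite_image.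
  by exists (f (Ordinal n_gt0)), (Ordinal n_gt0).
by exists x => j; rewrite /pullback -sigmaP; apply: xP; exists j.
Qed.

Lemma independent_family_arb_large : trivIset setT A ->
  (forall n, exists f : 'I_n -> G, independent_family (pullback act A) f) ->
  arb_large_independence act A.
Proof.
move=> A_triv indA n; have [f indf] := indA n.
exists (range f); split; first exact: finite_image; split=> [I _ _ If sigma|].
  have [x xP] := indf (sigma \o f); exists x => g /If[j _ <-]; exact: xP.
exists f; split=> //; apply: independent_family_inj indf; rewrite ?card_ord //.
exact: trivIset_pullback.
Qed.

Lemma arb_large_independence_htop_seq_gt0 (R : realType) : trivIset setT A ->
  arb_large_independence act A ->
  exists s, (0 < htop_seq R act (complements A) s)%E.
Proof.
move=> A_triv indA; have K_gt1 : (1 < #|'I_l|)%N by rewrite card_ord.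
have [n n_gt0|s indep] := @dyadic_independent_sequence _ _ _ (pullback act A).
  exact: arb_large_independence_family.
by exists s; exact: dyadic_independent_htop_seq_gt0.
Qed.

Lemma htop_seq_gt0_arb_large_independence (R : realType) (s : nat -> G) :
  trivIset setT A ->
  (0 < htop_seq R act (complements A) s)%E ->
  arb_large_independence act A.
Proof.
move=> A_triv hpos; apply: independent_family_arb_large => //.
by apply: htop_seq_gt0_independent hpos; rewrite ?card_ord.
Qed.

End IndependenceSets.

Lemma hausdorff_disjoint_nbhs (X : topologicalType) (I : finType) (y : I -> X) :
  hausdorff_space X -> injective y ->
  exists2 V : I -> set X, (forall i, nbhs (y i) (V i)) & trivIset setT V.
Proof.
rewrite open_hausdorff => X_haus y_inj.
have /choice[AB ABP] (ij : I * I) : exists AB : set X * set X,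
    [/\ nbhs (y ij.1) AB.1, nbhs (y ij.2) AB.2 &
        ij.1 != ij.2 -> AB.1 `&` AB.2 = set0].
  case: ij => i j /=; have [->|ij] := eqVneq i j.
    by exists (setT, setT); split => //; exact: filterT.
  have yij : y i != y j by apply: contra_neq ij => /y_inj.
  have [[A B] /= [/set_mem yA /set_mem yB] [oA oB /eqP AB]] := X_haus _ _ yij.
  by exists (A, B); split=> //; exact: open_nbhs_nbhs.
exists (fun i => [set x | forall j, (AB (i, j)).1 x /\ (AB (j, i)).2 x]) => [i|].
  apply: (@filter_forall _ _ _ (nbhs (y i))) => j; apply: filterI.
    by have [] := ABP (i, j).
  by have [] := ABP (j, i).
apply/trivIsetP => i j _ _ ij; rewrite -subset0 => x [/(_ j)[xA _] /(_ i)[_ xB]].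
by have [_ _ /(_ ij) <-] := ABP (i, j).
Qed.

Lemma regular_disjoint_closed_nbhs (X : topologicalType) (I : finType)
    (y : I -> X) (W : I -> set X) :
  regular_space X -> hausdorff_space X -> injective y ->
  (forall i, nbhs (y i) (W i)) ->
  exists U : I -> set X, [/\ forall i, closed (U i) /\ nbhs (y i) (U i),
    trivIset setT U & forall i, U i `<=` W i].
Proof.
move=> X_reg X_haus y_inj yW.
have [V yV V_triv] := hausdorff_disjoint_nbhs X_haus y_inj.
have /choice[E EP] i : exists E, nbhs (y i) E /\ closure E `<=` V i `&` W i.
  by have [E yE EVW] := X_reg (y i) _ (filterI (yV i) (yW i)); exists E.
exists (fun i => closure (E i)); split=> [i|i j _ _ [x [xi xj]]|i x].
- split; first exact: closed_closure.
  by apply: filterS (EP i).1; exact: subset_closure.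
- have [[Vix _] [Vjx _]] := ((EP i).2 x xi, (EP j).2 x xj).
  by apply: V_triv => //; exists x.
- by move=> /(EP i).2[].
Qed.

Lemma enum_range (T : eqType) (I : finType) (x : I -> T) :
  exists l, exists2 y : 'I_l -> T, injective y & range y = range x.
Proof.
pose r := undup (map x (enum I)).
exists (size r), (tnth (in_tuple r)).
  by apply/tuple_uniqP; rewrite undup_uniq.
apply/seteqP; split=> [_ [j _ <-]|_ [i _ <-]].
  have := mem_tnth j (in_tuple r); rewrite mem_undup => /mapP[i _ ->].
  by exists i.
have : x i \in in_tuple r by rewrite mem_undup map_f // mem_enum.
by move=> /tnthP[j ->]; exists j.
Qed.

Lemma range_factor (I J T : Type) (f : I -> T) (g : J -> T) :
  range f `<=` range g -> exists h : I -> J, forall i, g (h i) = f i.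
Proof.
move=> fg; have /choice[h hP] i : exists j, g j = f i.
  by have [j _ gj] := fg _ (imageT f i); exists j.
by exists h.
Qed.

Lemma off_diagonal_gt1 (X : Type) (k l : nat) (x : 'I_k -> X) (y : 'I_l -> X) :
  off_diagonal x -> range y = range x -> 1 < l.
Proof.
move=> offx yx; rewrite ltnNge; apply/negP => l_le1; apply: offx => i j.
have [|h hx] := @range_factor _ _ _ x y; first by rewrite yx.
rewrite -!hx; congr y; apply/ord_inj.
have := ltn_ord (h i); have := ltn_ord (h j); lia.
Qed.

Section TupleEquivalence.
Variables (R : realType) (G : Type) (X : topologicalType) (act : G -> X -> X).
Variables (k : nat) (x : 'I_k -> X).

Lemma sequence_entropy_tuple_IN : compact [set: X] -> hausdorff_space X ->
  sequence_entropy_tuple R act x -> IN_tuple act x.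
Proof.
move=> X_cpt X_haus [offx seqx] V xV.
have X_reg : regular_space X by move=> z; exact: compact_regular X_haus X_cpt filterT.
have [l [y y_inj yx]] := enum_range x.
have [|h hx] := @range_factor _ _ _ x y; first by rewrite yx.
pose W j : set X := [set z | forall i, h i = j -> V i z].
have yW j : nbhs (y j) (W j).
  apply: (@filter_forall _ _ (fun i z => h i = j -> V i z)) => i.
  have [<-|hij] := pselect (h i = j); last exact: nearW.
  by rewrite hx; apply: filterS (xV i).
have [U [U_nbhs U_triv UW]] := regular_disjoint_closed_nbhs X_reg X_haus y_inj yW.
have [|s hpos] := seqx l y y_inj yx U U_nbhs.
  by move=> i j; exact: (trivIsetP.1 U_triv).
apply: (@arb_large_independence_mono _ _ _ _ _ h U) => [i z /UW|]; first exact.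
exact: (htop_seq_gt0_arb_large_independence (off_diagonal_gt1 offx yx) U_triv hpos).
Qed.

Lemma IN_sequence_entropy_tuple : off_diagonal x ->
  IN_tuple act x -> sequence_entropy_tuple R act x.
Proof.
move=> offx INx; split=> // l y y_inj yx U U_nbhs U_disj.
apply: (arb_large_independence_htop_seq_gt0 (off_diagonal_gt1 offx yx)).
  by apply/trivIsetP => i j _ _; exact: U_disj.
have [|h hx] := @range_factor _ _ _ x y; first by rewrite yx.
have [|r rx] := @range_factor _ _ _ y x; first by rewrite yx.
apply: (@arb_large_independence_mono _ _ _ _ _ r (U \o h)) => [j|].
  by rewrite /= (_ : h (r j) = j) //; apply: y_inj; rewrite hx.
by apply: INx => i; rewrite -hx; exact: (U_nbhs (h i)).2.
Qed.

End TupleEquivalence.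

Local Open Scope ring_scope.

Theorem theorem5p9 (R : realType) (G : topologicalType) (mul : G -> G -> G) (e : G)
  (X : topologicalType) (act : G -> X -> X)
  (mulA : forall a b c, mul a (mul b c) = mul (mul a b) c)
  (mul1g : forall a, mul e a = a) (mulg1 : forall a, mul a e = a)
  (mul_cont : continuous (fun p : G * G => mul p.1 p.2))
  (act1 : forall x, act e x = x)
  (actM : forall s t x, act (mul s t) x = act s (act t x))
  (act_cont : continuous (fun p : G * X => act p.1 p.2))
  (act_cont_s : forall s, continuous (act s))
  (act_surj : forall s (y : X), exists z, act s z = y)
  (X_compact : compact [set: X]) (X_hausdorff : hausdorff_space X)
  (k : nat) (hk : (2 <= k)%N) (x : 'I_k -> X) (hx : off_diagonal x) :
  sequence_entropy_tuple R act x <-> IN_tuple act x.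
Proof.
split; first exact: sequence_entropy_tuple_IN.
exact: IN_sequence_entropy_tuple.
Qed.
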